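(* Let $X$ be a connected weakly orderable normal space. Then $X$ densely embeds into an irreducible continuum of the same weight as $X$ (that is, there is a homeomorphic embedding of $X$ onto a dense subspace of such a continuum). In particular, if $X$ is separable metrizable, then $X$ densely embeds into an irreducible metrizable continuum.
   Context: A continuum is a connected compact Hausdorff space; a subcontinuum is a subspace that is a continuum. A Hausdorff arc is a linearly ordered (Hausdorff) continuum, i.e. a continuum whose topology is the order topology of some linear order. A space $X$ is weakly orderable if there is a continuous one-to-one mapping of $X$ into a Hausdorff arc. A continuum $K$ is irreducible between $a$ and $b$ if no proper subcontinuum of $K$ contains both $a$ and $b$; $K$ is irreducible if it is irreducible between some two of its points. The weight of a space is the least cardinality of a basis for it. *)

(* Defs.v *)
From mathcomp Require Import all_boot all_order all_algebra.
From mathcomp Require Import all_classical all_reals all_analysis.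

Set Implicit Arguments.
Unset Strict Implicit.
Unset Printing Implicit Defensive.

Local Open Scope classical_set_scope.
Local Open Scope card_scope.
Local Open Scope ring_scope.

Definition continuum (K : topologicalType) : Prop :=
  [/\ hausdorff_space K, compact [set: K] & connected [set: K]].

(* Meant for Hausdorff [K], where every subspace is Hausdorff. *)
Definition subcontinuum (K : topologicalType) (A : set K) : Prop :=
  compact A /\ connected A.

Definition irreducible_between (K : topologicalType) (a b : K) : Prop :=
  forall A : set K, subcontinuum A -> A a -> A b -> A = [set: K].

(* [a] and [b] may coincide, which happens only for a one-point [K]. *)
Definition irreducible_continuum (K : topologicalType) : Prop :=
  continuum K /\ exists a b : K, irreducible_between a b.

(* The order of an [orderTopologicalType] is total and its topology is the
   order topology. *)
Definition hausdorff_arc d (L : orderTopologicalType d) : Prop := continuum L.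

Definition weakly_orderable (X : topologicalType) : Prop :=
  exists (d : Order.disp_t) (L : orderTopologicalType d) (f : X -> L),
    [/\ hausdorff_arc L, continuous f & injective f].

(* The weight of [T] is the cardinality of any such [B]. *)
Definition least_basis (T : topologicalType) (B : set (set T)) : Prop :=
  basis B /\ forall C : set (set T), basis C -> B #<= C.

Definition same_weight (S T : topologicalType) : Prop :=
  exists (B : set (set S)) (C : set (set T)),
    [/\ least_basis B, least_basis C & B #= C].

(* The last clause says that [f] is open onto its image. *)
Definition embedding (S T : topologicalType) (f : S -> T) : Prop :=
  [/\ continuous f, injective f &
      forall U : set S, open U -> exists2 V, open V & f @` U = range f `&` V].

Definition densely_embeds (S T : topologicalType) : Prop :=
  exists f : S -> T, embedding f /\ dense (range f).

Definition separable (T : topologicalType) : Prop :=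
  exists2 D : set T, countable D & dense D.

Definition metric_on (R : realType) (T : Type) (dist : T -> T -> R) : Prop :=
  [/\ forall x, dist x x = 0,
      forall x y, dist x y = 0 -> x = y,
      forall x y, dist x y = dist y x &
      forall x y z, dist x z <= dist x y + dist y z].

Definition metrizable (R : realType) (T : topologicalType) : Prop :=
  exists2 dist : T -> T -> R, metric_on dist &
    forall x : T, nbhs x =
      filter_from [set e | 0 < e] (fun e => [set y | dist x y < e]).

(* Main.v *)
Require Import Defs.
From mathcomp Require Import all_boot all_order all_algebra.
From mathcomp Require Import all_classical all_reals all_analysis.
From mathcomp Require Import lra.

(** Let [f] be a continuous injection of [X] into an arc, and order [X] by [f].
    Fix a basis [B] of [X] of least cardinality and pick a point [p] in each
    nonempty member of [B]; these points form a dense set [D]. Urysohn functions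
    indexed by pairs of members of [B] separate points from closed sets; adding,
    for [p] in [D] and [U] in [B] containing [p], a Urysohn function for the
    disjoint closed sets [(-oo, p] \ U] and [[p, +oo) \ U] makes the closures of
    [(-oo, p]] and [[p, +oo)] meet only in [p] in the compactification [K] of [X]
    inside the cube on all these functions. Hence every [p] in [D] cuts [K]
    between a point [a] in the closures of all the initial rays and a point [b]
    in the closures of all the final rays, so that a subcontinuum containing [a]
    and [b] contains [D], hence is [K]. The number of functions is at most
    [#|B|^2], which gives the weight when [B] is infinite, and a metric on [K]
    when [B] is countable. *)

Set Implicit Arguments.
Unset Strict Implicit.
Unset Printing Implicit Defensive.

Import Order.TTheory GRing.Theory Num.Theory.
Import numFieldNormedType.Exports.
Local Open Scope classical_set_scope.
Local Open Scope ring_scope.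

(** * Cardinal arithmetic *)

Lemma set_inj_card_le (T U : Type) (A : set T) (B : set U) (f : T -> U) :
  (forall x, A x -> B (f x)) ->
  (forall x y, A x -> A y -> f x = f y -> x = y) -> (A #<= B)%card.
Proof.
move=> AB finj; apply/card_leP.
pose F (x : A) : B := SigSub (mem_set (AB _ (set_valP x))).
have Finj : {in [set: A] &, injective F}.
  move=> x y _ _ /(congr1 val) /= /finj e; apply: val_inj; apply: e; exact: set_valP.
apply/injfunPex; exists F => //.
Qed.

(** The value [u0] is a filler off [A]: it makes the injection a function on all of [T], so that
    later constructions avoid subtypes. *)
Lemma card_le_set_inj (T U : Type) (u0 : U) (A : set T) (B : set U) :
  (A #<= B)%card -> exists f : T -> U, (forall x, A x -> B (f x)) /\
    (forall x y, A x -> A y -> f x = f y -> x = y).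
Proof.
move=> /card_leP /injfunPex[F _ Finj].
exists (fun x => if pselect (A x) is left h then val (F (SigSub (mem_set h)))
                 else u0); split=> [x Ax|x y Ax Ay].
  by case: pselect => // h; exact: set_valP.
case: pselect => // h1; case: pselect => // h2 /val_inj e.
by have := Finj _ _ (mem_set I) (mem_set I) e => /(congr1 val).
Qed.

(* Hönig's argument: take a maximal family of choice functions for [F] any two
   of which differ at every member of [F]; by maximality, their values exhaust
   some member of [F], which is then the least one. *)
Lemma exists_least_card (T : Type) (F : set (set T)) : F !=set0 ->
  exists2 A, F A & forall C, F C -> (A #<= C)%card.
Proof.
move=> [A0 FA0].
have [[t0 _]|A0e] := pselect (A0 !=set0); last first.
  exists A0 => // C _; suff -> : A0 = set0 by exact: card_ge0.
  by apply/seteqP; split=> // x A0x; apply: A0e; exists x.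
pose P (H : set (set T -> T)) := (forall h C, H h -> F C -> C (h C)) /\
  (forall h h' C, H h -> H h' -> F C -> h C = h' C -> h = h').
have [G GP Gtot|H [[HC Hinj] Hmax]] := @Zorn_bigcup _ P.
  split=> [h C [H GH Hh]|h h' C [H GH Hh] [H' GH' Hh']].
    by have [GC _] := GP _ GH; exact: GC.
  have [HH'|H'H] := Gtot _ _ GH GH'.
    by have [_ Ginj] := GP _ GH'; apply: (Ginj h h' C) => //; exact: HH'.
  by have [_ Ginj] := GP _ GH; apply: (Ginj h h' C) => //; exact: H'H.
have [[C0 [FC0 C0H]]|noC] :=
    pselect (exists C0, F C0 /\ forall t, C0 t -> exists2 h, H h & h C0 = t).
  exists C0 => // C FC.
  apply: (@card_le_trans _ _ _ H).
    suff -> : C0 = (fun h => h C0) @` H by exact: card_image_le.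
    apply/seteqP; split=> [t /C0H[h ? <-]|_ [h Hh <-]]; first by exists h.
    by apply: (HC h C0).
  apply: (@set_inj_card_le _ _ _ _ (fun h => h C)).
    by move=> h Hh; exact: (HC h C).
  by move=> h h' Hh Hh'; exact: (Hinj h h' C).
have /choice[h0 h0P] : forall C, exists t, F C -> C t /\ forall h, H h -> h C <> t.
  move=> C; have [FC|] := pselect (F C); last by exists t0.
  apply: contrapT => nt; apply: noC; exists C; split => // t Ct.
  apply: contrapT => nh; apply: nt; exists t => _; split => // h Hh hC.
  by apply: nh; exists h.
have nHh0 : ~ H h0 by move=> Hh0; have [_ /(_ _ Hh0)] := h0P _ FA0.
exfalso; apply: (Hmax (H `|` [set h0])).
  split; first by move=> h; left.
  by move=> /(_ h0) Hh0; apply: nHh0; apply: Hh0; right.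
split=> [h C [Hh|->] FC|h h' C [Hh|->] [Hh'|->] FC //].
- exact: (HC h C).
- by have [] := h0P _ FC.
- exact: (Hinj h h' C).
- by have [_ /(_ _ Hh)] := h0P _ FC.
- by have [_ /(_ _ Hh') n] := h0P _ FC => /esym.
Qed.

(** A least member of the family [[set A; B]] injects into the other one. *)
Lemma card_le_total (T : Type) (A B : set T) :
  (A #<= B)%card \/ (B #<= A)%card.
Proof.
have [|C [->|->] CAB] := @exists_least_card T [set A; B]; first by exists A; left.
- by left; apply: CAB; right.
- by right; apply: CAB; left.
Qed.

(** * Pairing functions and codes of finite lists on an infinite type *)

Section pairing.
Variable T : Type.

(** Reading the base set off the diagonal lets Zorn's lemma run on graphs ordered by inclusion
    alone. *)
Let dom (G : set (T * T * T)) : set T := [set a | exists c, G (a, a, c)].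

(** These are the graphs of injections [M * M -> M] with [M = dom G]. *)
Let pairing_graph (G : set (T * T * T)) := [/\
  (forall a b c, G (a, b, c) -> [/\ dom G a, dom G b & dom G c]),
  (forall a b, dom G a -> dom G b -> exists c, G (a, b, c)),
  (forall a b c c', G (a, b, c) -> G (a, b, c') -> c = c') &
  (forall a b a' b' c, G (a, b, c) -> G (a', b', c) -> a = a' /\ b = b')].

Let dom_sub G G' : G `<=` G' -> dom G `<=` dom G'.
Proof. by move=> GG' a [c /GG']; exists c. Qed.

Let pairing_of (M : set T) (p : T -> T -> T) :
  (forall a b, M a -> M b -> M (p a b)) ->
  (forall a b a' b', M a -> M b -> M a' -> M b' -> p a b = p a' b' ->
    a = a' /\ b = b') ->
  pairing_graph [set x | [/\ M x.1.1, M x.1.2 & x.2 = p x.1.1 x.1.2]] /\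
  dom [set x | [/\ M x.1.1, M x.1.2 & x.2 = p x.1.1 x.1.2]] = M.
Proof.
move=> pM pinj; set G := [set x | _].
have domG : dom G = M.
  by apply/seteqP; split=> [a [c []]|a Ma] //=; exists (p a a).
split=> //; rewrite /pairing_graph domG; split.
- by move=> a b c [/= Ma Mb ->]; split => //; exact: pM.
- by move=> a b Ma Mb; exists (p a b).
- by move=> a b c c' [/= _ _ ->] [].
- by move=> a b a' b' c [/= ? ? ->] [/= ? ? ]; exact: pinj.
Qed.

(** Zorn's lemma gives a maximal injection [q : M * M -> M] with [M] infinite. If the complement of
    [M] injects into [M], so does [T], and [q] pairs all of [T]. Otherwise the complement contains a
    copy [N] of [M], and [q] extends to the union of [M] and [N], against maximality. *)
Lemma infinite_pairing : infinite_set [set: T] ->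
  exists p : T -> T -> T, forall a b a' b', p a b = p a' b' -> a = a' /\ b = b'.
Proof.
move=> infT.
have [t0 _] : [set: T] !=set0 by exact: infinite_setN0.
pose P (G : set (T * T * T)) := G = set0 \/ infinite_set (dom G) /\ pairing_graph G.
have [F FP Ftot|G [PG Gmax]] := @Zorn_bigcup _ P.
  have [F0|/existsNP[G0 /not_implyP[FG0 G0n]]] :=
      pselect (forall G, F G -> G = set0).
    by left; apply/seteqP; split=> // x [G /F0 ->].
  right.
  have pgF G x : F G -> G x -> pairing_graph G.
    by move=> /FP[->//|[]].
  have up x y : (\bigcup_(X in F) X) x -> (\bigcup_(X in F) X) y ->
      exists G, [/\ F G, G x & G y].
    move=> [G FG Gx] [H FH Hy]; have [GH|HG] := Ftot _ _ FG FH.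
      by exists H; split=> //; exact: GH.
    by exists G; split=> //; exact: HG.
  have Fsub G : F G -> G `<=` \bigcup_(X in F) X by move=> FG x Gx; exists G.
  split.
    have [//|[infG0 _]] := FP _ FG0.
    by apply: sub_infinite_set infG0; apply: dom_sub; exact: Fsub.
  split.
  - move=> a b c [G FG Gabc]; have [Gd _ _ _] := pgF _ _ FG Gabc.
    have [da db dc] := Gd _ _ _ Gabc.
    by split; apply: (dom_sub (Fsub _ FG)).
  - move=> a b [c Gc] [d Gd]; have [G [FG Gac Gbd]] := up _ _ Gc Gd.
    have [_ Gt _ _] := pgF _ _ FG Gac.
    have [|| e Ge] := Gt a b; [by exists c | by exists d |].
    by exists e; exists G.
  - move=> a b c c' h h'; have [G [FG Gac Gbd]] := up _ _ h h'.
    have [_ _ Gf _] := pgF _ _ FG Gac.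
    exact: Gf Gac Gbd.
  - move=> a b a' b' c h h'; have [G [FG Gac Gbd]] := up _ _ h h'.
    have [_ _ _ Gi] := pgF _ _ FG Gac.
    exact: Gi Gac Gbd.
have {PG} [G0|[infM [Gd Gt Gf Gi]]] := PG.
  (* The empty graph is not maximal: transporting a pairing [j] of the natural numbers to their copy
     [range i] gives a larger graph. *)
  have /(card_le_set_inj t0)[i [_ iinj]] : ([set: nat] #<= [set: T])%card by apply/infiniteP.
  have /(card_le_set_inj 0%N)[j [_ jinj]] : ([set: nat * nat] #<= [set: nat])%card.
    by have := card_nat2; rewrite card_eq_le => /andP[].
  have {}iinj x y : i x = i y -> x = y by move=> /iinj; apply.
  have {}jinj x y : j x = j y -> x = y by move=> /jinj; apply.
  pose i' a := xget 0%N [set n | i n = a].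
  have i'K a : range i a -> i (i' a) = a.
    by move=> [n _ <-]; rewrite /i'; case: xgetP => [_ ->|/(_ n)/(_ erefl)].
  have [||PG domG] := @pairing_of (range i) (fun a b => i (j (i' a, i' b))).
  - by move=> a b _ _; eexists.
  - move=> a b a' b' ra rb ra' rb' /iinj/jinj[ea eb].
    by rewrite -(i'K a)// -(i'K b)// ea eb !i'K.
  exfalso; apply: (Gmax _ _ (or_intror (conj _ PG))); last first.
    rewrite domG; apply/infiniteP; apply: (@set_inj_card_le _ _ _ _ i).
      by move=> n _; exists n.
    by move=> x y _ _; exact: iinj.
  rewrite G0; split=> // /(_ (i 0%N, i 0%N, i (j (i' (i 0%N), i' (i 0%N)))))[].
  by split => //=; exists 0%N.
pose M := dom G.
have [q qP] : exists q : T -> T -> T, forall a b, M a -> M b -> G (a, b, q a b).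
  have /choice[q qP] : forall ab, exists c, M ab.1 -> M ab.2 -> G (ab.1, ab.2, c).
    move=> [a b]; have [[Ma Mb]|n] := pselect (M a /\ M b).
      by have [c] := Gt _ _ Ma Mb; exists c.
    by exists t0 => Ma Mb; exfalso; apply: n.
  by exists (fun a b => q (a, b)) => a b; exact: (qP (a, b)).
have qM a b : M a -> M b -> M (q a b) by move=> Ma Mb; have [] := Gd _ _ _ (qP _ _ Ma Mb).
have qinj a b a' b' : M a -> M b -> M a' -> M b' -> q a b = q a' b' ->
    a = a' /\ b = b'.
  by move=> Ma Mb Ma' Mb' e; apply: (Gi _ _ _ _ (q a b)); [|rewrite e]; exact: qP.
have [m0 [m1 [Mm0 Mm1 m01]]] : exists m0 m1, [/\ M m0, M m1 & m0 <> m1].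
  have [m0 Mm0] := infinite_setN0 infM.
  have [m1 [Mm1 n]] := infinite_setN0 (infinite_setD infM (finite_set1 m0)).
  by exists m0, m1; split => // e; apply: n.
(* If [N] injects into [M], so does the union of [M] and [N]: [q] tags the points of [M] with [m0]
   and the others with [m1]. *)
have double N h : (forall x, N x -> M (h x)) ->
    (forall x y, N x -> N y -> h x = h y -> x = y) ->
    exists k, (forall x, M x \/ N x -> M (k x)) /\
      (forall x y, M x \/ N x -> M y \/ N y -> k x = k y -> x = y).
  move=> hM hinj.
  exists (fun x => if pselect (M x) then q m0 x else q m1 (h x)); split.
    move=> x; case: pselect => [Mx _|nMx [//|Nx]]; apply: qM => //; exact: hM.
  move=> x y; case: pselect => Mx; case: pselect => My xMN yMN e.
  - by have [] := qinj _ _ _ _ Mm0 Mx Mm0 My e.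
  - have {yMN}Ny : N y by case: yMN.
    by have [] := qinj _ _ _ _ Mm0 Mx Mm1 (hM _ Ny) e.
  - have {xMN}Nx : N x by case: xMN.
    by have [/esym] := qinj _ _ _ _ Mm1 (hM _ Nx) Mm0 My e.
  - have {yMN}Ny : N y by case: yMN.
    have {xMN}Nx : N x by case: xMN.
    by apply: hinj => //; have [] := qinj _ _ _ _ Mm1 (hM _ Nx) Mm1 (hM _ Ny) e.
have [|] := card_le_total (~` M) M.
  move=> /(card_le_set_inj t0)[h [hM hinj]].
  have [k [kM kinj]] := double _ _ hM hinj.
  have MN x : M x \/ (~` M) x by exact: EM.
  exists (fun a b => q (k a) (k b)) => a b a' b' e.
  have {e}[] := qinj _ _ _ _ (kM _ (MN a)) (kM _ (MN b)) (kM _ (MN a')) (kM _ (MN b')) e.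
  by split; apply: kinj.
move=> /(card_le_set_inj t0)[h [hM hinj]].
pose N := h @` M.
have /choice[h' h'P] : forall x, exists y, N x -> M y /\ h y = x.
  move=> x; have [[y My yx]|nNx] := pselect (N x); first by exists y.
  by exists t0.
have [||k [kM kinj]] := double N h'.
- by move=> x /h'P[].
- by move=> x y /h'P[_ ex] /h'P[_ ey] e; rewrite -ex -ey e.
(* [r] agrees with [q] on [M] and sends every other pair into [N], which is disjoint from [M]; so
   values of the two kinds never collide. *)
pose r a b := if pselect (M a /\ M b) then q a b else h (q (k a) (k b)).
have [||Pr domr] := @pairing_of (M `|` N) r.
- move=> a b Ma Mb; rewrite /r; case: pselect => [ab|nab]; first by left; apply: qM; case: ab.
  by right; exists (q (k a) (k b)) => //; apply: qM; exact: kM.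
- move=> a b a' b' Ma Mb Ma' Mb'; rewrite /r.
  case: pselect => ab; case: pselect => ab'; (try case: (ab) => ma mb);
    (try case: (ab') => ma' mb').
  + exact: qinj.
  + move=> /= e; exfalso; apply: (hM (q (k a') (k b'))); first by apply: qM; exact: kM.
    by rewrite -e; exact: qM.
  + move=> /= e; exfalso; apply: (hM (q (k a) (k b))); first by apply: qM; exact: kM.
    by rewrite e; exact: qM.
  + move=> /= e.
    have {}e := hinj _ _ (qM _ _ (kM _ Ma) (kM _ Mb)) (qM _ _ (kM _ Ma') (kM _ Mb')) e.
    have {e}[] := qinj _ _ _ _ (kM _ Ma) (kM _ Mb) (kM _ Ma') (kM _ Mb') e.
    by split; apply: kinj.
exfalso; apply: (Gmax _ _ (or_intror (conj _ Pr))); last first.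
  by rewrite domr; apply: sub_infinite_set infM; left.
split.
  move=> [[a b] c] /[dup] Gabc /Gd[Ma Mb Mc]; split; [by left|by left|].
  rewrite /r/=; case: pselect => [Mab|n]; last by exfalso; apply: n.
  exact: Gf Gabc (qP _ _ Ma Mb).
(* The extension is strict: [h m0] lies in its domain but outside [M]. *)
move=> rG; have Nhm0 : N (h m0) by exists m0.
have /rG/Gd[Mh _ _] : [set x | [/\ (M `|` N) x.1.1, (M `|` N) x.1.2 &
    x.2 = r x.1.1 x.1.2]] (h m0, h m0, r (h m0) (h m0)) by split=> //; right.
exact: (hM m0).
Qed.

End pairing.

(** A list is coded by nested pairs; the distinct tags [a] and [b] tell the empty list from the
    others. *)
Lemma infinite_seq_coding (T : Type) : infinite_set [set: T] ->
  exists c : seq T -> T, injective c.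
Proof.
move=> infT; have [p pinj] := infinite_pairing infT.
have [a _] := infinite_setN0 infT.
have [b [_ ba]] := infinite_setN0 (infinite_setD infT (finite_set1 a)).
exists (fix c s := if s is x :: s' then p b (p x (c s')) else p a a).
elim=> [|x s IH] [|y t] //= => [/pinj[/esym]|/pinj[]|/pinj[_ /pinj[-> /IH ->]]] //.
Qed.

(** * Compact spaces with a point-separating family of real functions *)

Lemma nbhs_set_typeP (T : topologicalType) (A : set T) (x : set_type A)
    (U : set (set_type A)) : nbhs x U ->
  exists2 W, open_nbhs (val x) W & forall y : set_type A, W (val y) -> U y.
Proof.
by move=> [_ [[W oW <-] Wx WU]]; exists W.
Qed.

Lemma val_set_type_continuous (T : topologicalType) (A : set T) :
  continuous (val : set_type A -> T).
Proof. exact: initial_continuous. Qed.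

Lemma compact_set_type (T : topologicalType) (A : set T) :
  compact A -> compact [set: set_type A].
Proof.
move=> cA F FF _; have [|p [Ap clp]] := cA ((val : set_type A -> T) @ F) _.
  rewrite nbhs_simpl/=; apply: filterS (filterT : F setT) => x _; exact: set_valP.
exists (SigSub (mem_set Ap)); split=> // B U FB /nbhs_set_typeP[W [oW /= Wp] WU].
have [|_ [[k Bk <-] Wk]] := clp (val @` B) W _ (open_nbhs_nbhs (conj oW Wp)).
  by rewrite nbhs_simpl/=; apply: filterS FB => x Bx; exists x.
by exists k; split => //; exact: WU.
Qed.

Lemma hausdorff_set_type (T : topologicalType) (A : set T) :
  hausdorff_space T -> hausdorff_space (set_type A).
Proof.
move=> hT x y clxy; apply: val_inj; apply: hT => B C nB nC.
have [||z [Bz Cz]] := clxy (val @^-1` B) (val @^-1` C).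
- exact: (@val_set_type_continuous T A x B nB).
- exact: (@val_set_type_continuous T A y C nC).
- by exists (val z).
Qed.

Lemma dense_closure (T : topologicalType) (A : set T) :
  dense A <-> closure A = [set: T].
Proof.
split=> [dA|clA O [x Ox] oO].
  apply/seteqP; split=> // x _ U; rewrite nbhsE => -[V [oV Vx] VU].
  by have [y [Vy Ay]] := dA V (ex_intro _ x Vx) oV; exists y; split => //; exact: VU.
have : closure A x by rewrite clA.
by move=> /(_ O (open_nbhs_nbhs (conj oO Ox)))[y [Ay Oy]]; exists y.
Qed.

Section compact_separating_family.
Variables (R : realType) (K : topologicalType) (S : Type) (g : S -> K -> R).
Hypotheses (cK : compact [set: K]) (hK : hausdorff_space K).
Hypothesis g_cont : forall s, continuous (g s).
Hypothesis g_sep : forall x y, (forall s, g s x = g s y) -> x = y.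

Let open_lt s r : open [set y | g s y < r].
Proof.
apply: (@open_comp _ _ (g s) [set t | t < r]); last exact: open_lt.
by move=> x _; exact: g_cont.
Qed.

Let open_gt s r : open [set y | r < g s y].
Proof.
apply: (@open_comp _ _ (g s) [set t | r < t]); last exact: open_gt.
by move=> x _; exact: g_cont.
Qed.

(** Rational bounds keep the index type no larger than [S] when [S] is infinite. *)
Let ray (i : S * rat * bool) : set K :=
  if i.2 then [set y | ratr i.1.2 < g i.1.1 y] else [set y | g i.1.1 y < ratr i.1.2].

Fixpoint box (l : seq (S * rat * bool)) : set K :=
  if l is i :: l' then ray i `&` box l' else setT.

Let box_cat l m : box (l ++ m) = box l `&` box m.
Proof. by elim: l => [|i l /= ->]; rewrite ?setTI ?setIA. Qed.

Let open_box l : open (box l).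
Proof.
elim: l => [|[[s r] []] l IH] /=; [exact: openT|apply: openI => //..].
  exact: open_gt.
exact: open_lt.
Qed.

(** The boxes around [x] generate a filter. A point [y] other than [x] is not a cluster point, since
    a rational lies strictly between [g s x] and [g s y] for some [s]. In a compact Hausdorff space
    a filter with the single cluster point [x] converges to [x]. *)
Lemma basis_box : basis (range box).
Proof.
split=> [_ [l _ <-]|x]; first exact: open_box.
set F := filter_from _ _.
have FF : ProperFilter F.
  apply: filter_from_proper => [|U [_ Ux]]; last by exists x.
  apply: filter_from_filter; first by exists setT; split => //; exists [::].
  move=> _ _ [[l _ <-] lx] [[m _ <-] mx]; exists (box l `&` box m) => //.
  by split => //; exists (l ++ m) => //; exact: box_cat.
have Fray i : ray i x -> F (ray i).
  move=> ix; exists (box [:: i]); last by rewrite /= setIT.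
  by split; [exists [:: i]|split].
apply: (compact_cluster_set1 hK cK) => //; [exact: filterT|exact: filterT|].
apply/seteqP; split=> [y Fy|_ -> A B [U [_ Ux] UA] /nbhs_singleton Bx]; last first.
  by exists x; split => //; exact: UA.
apply: g_sep => s; apply: contrapT => /eqP; rewrite neq_lt => /orP[] yx.
  have [r] := rat_in_itvoo yx; rewrite in_itv/= => /andP[yr rx].
  have [z [/= rz zr]] := Fy _ _ (Fray (s, r, true) rx)
    (open_nbhs_nbhs (conj (@open_lt s (ratr r)) yr)).
  by have := lt_trans rz zr; rewrite ltxx.
have [r] := rat_in_itvoo yx; rewrite in_itv/= => /andP[xr ry].
have [z [/= zr rz]] := Fy _ _ (Fray (s, r, false) xr)
  (open_nbhs_nbhs (conj (@open_gt s (ratr r)) ry)).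
by have := lt_trans rz zr; rewrite ltxx.
Qed.

End compact_separating_family.

Lemma compact_metrizable (R : realType) (K : topologicalType)
    (g : nat -> K -> R) :
  compact [set: K] -> hausdorff_space K ->
  (forall n, continuous (g n)) -> (forall n x, 0 <= g n x <= 1) ->
  (forall x y, (forall n, g n x = g n y) -> x = y) -> metrizable R K.
Proof.
move=> cK hK g_cont g01 g_sep.
(* The metric is the supremum of the [t n]. The denominators make [t n] uniformly small for large
   [n], so that only finitely many terms matter for a given radius. *)
pose t n x y := `|g n x - g n y| / n.+1%:R.
have t0 n x y : 0 <= t n x y by rewrite divr_ge0.
have t_inv n x y : t n x y <= n.+1%:R^-1.
  rewrite ler_piMl// ler_norml; have := g01 n x; have := g01 n y; lra.
have t1 n x y : t n x y <= 1.
  by apply: le_trans (t_inv n x y) _; rewrite invf_le1// ler1n.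
pose d x y := sup (range (fun n => t n x y)).
have hs x y : has_sup (range (fun n => t n x y)).
  by split; [exists (t 0%N x y), 0%N|exists 1 => _ [n _ <-]].
have td n x y : t n x y <= d x y by apply: sup_upper_bound => //; exists n.
have dt x y c : (forall n, t n x y <= c) -> d x y <= c.
  by move=> tc; apply: ge_sup; [exact: (hs x y).1|move=> _ [n _ <-]].
have d0 x y : 0 <= d x y := le_trans (t0 0%N x y) (td 0%N x y).
have dxx x : d x x = 0.
  by apply/eqP; rewrite eq_le d0 andbT; apply: (dt x x) => n; rewrite /t subrr normr0 mul0r.
have tC n x y : t n x y = t n y x by rewrite /t distrC.
have dC x y : d x y = d y x.
  by congr (sup _); apply: eq_imagel => n _; exact: tC.
have tD n x y z : t n x z <= t n x y + t n y z.
  by rewrite -mulrDl ler_pM2r ?invr_gt0// ler_distD.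
have tsep x y : (forall n, t n x y <= 0) -> x = y.
  move=> t00; apply: g_sep => n; have /eqP : t n x y = 0.
    by apply/eqP; rewrite eq_le t00 t0.
  by rewrite mulf_eq0 invr_eq0 pnatr_eq0 orbF normr_eq0 subr_eq0 => /eqP.
have open_ball n x e : 0 < e -> nbhs x [set y | t n x y < e].
  move=> e0.
  have : nbhs (g n x) [set r | `|g n x - r| < e].
    by apply/nbhs_ballP; exists e => //.
  move=> /(g_cont n x) gx.
  apply: (@filterS _ (nbhs x) _ (g n @^-1` _) _ _ gx) => y /= h.
  apply: le_lt_trans h.
  by rewrite ler_piMr// invf_le1// ler1n.
exists d.
  split=> // [x y dxy|x y z].
    by apply: tsep => n; rewrite -dxy; exact: (td n x y).
  apply: (dt x z) => n; apply: le_trans (tD n x y z) _.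
  by apply: lerD; [exact: (td n x y)|exact: (td n y z)].
move=> x; apply/seteqP; split; last first.
  (* For [n >= N] the bound [1 / (n + 1)] is at most [e / 2]. Half the radius is used because a
     supremum of terms below [e] could equal [e]. *)
  move=> U [e /= e0 eU]; pose N := Num.truncn (e / 2)^-1.
  have : nbhs x [set y | forall n, (n < N)%N -> t n x y < e / 2].
    elim: N => [|N IH]; first by apply: filterS filterT.
    have e2 : 0 < e / 2 by lra.
    apply: filterS (filterI IH (open_ball N x _ e2)) => y [/= tN tNe] n.
    by rewrite ltnS leq_eqVlt => /orP[/eqP->|/tN].
  apply: filterS => y /= tN; apply: eU => /=.
  suff : d x y <= e / 2 by lra.
  apply: (dt x y) => n; have [nN|Nn] := ltnP n N; first exact/ltW/(tN n nN).
  apply: le_trans (t_inv n x y) _; rewrite -[leRHS]invrK lef_pV2 ?posrE ?invr_gt0; try lra.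
    apply: le_trans (ltW (truncnS_gt _)) _; by rewrite ler_nat ltnS.
  by [].
set F := filter_from _ _.
have FF : ProperFilter F.
  apply: filter_from_proper => [|e /= e0]; last by exists x => /=; rewrite dxx.
  apply: filter_from_filter; first by exists 1; exact: ltr01.
  move=> e f /= e0 f0; exists (Num.min e f); first by rewrite /= lt_min e0.
  by move=> y; rewrite /= lt_min => /andP[].
suff : F --> x by [].
(* By compactness the balls around [x] converge to [x] once [x] is their only cluster point; if
   [t n x y > 0], half of this value is a radius that separates [y] from [x]. *)
apply: (compact_cluster_set1 hK cK) => //; [exact: filterT|exact: filterT|].
apply/seteqP; split=> [y Fy|_ -> A B [e /= e0 eA] /nbhs_singleton Bx]; last first.
  by exists x; split => //; apply: eA => /=; rewrite dxx.
rewrite /=; apply/esym/tsep => n; rewrite leNgt; apply/negP => txy.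
have e0 : 0 < t n x y / 2 by lra.
have Fball : F [set z | d x z < t n x y / 2] by exists (t n x y / 2).
have [z [/= xz yz]] := Fy _ _ Fball (open_ball n y _ e0).
have := tD n x z y; have := td n x z; have := tC n z y; lra.
Qed.

(* The closure of the image of [X] in the cube [[0, 1]^S] under [x |-> (g s x)_s]. *)
Lemma cube_compactification (R : realType) (X : topologicalType) (S : choiceType)
    (g : S -> X -> R) :
  hausdorff_space X ->
  (forall s, continuous (g s)) -> (forall s x, 0 <= g s x <= 1) ->
  (forall U x, open U -> U x ->
    exists s, g s x = 0 /\ forall y, ~ U y -> g s y = 1) ->
  exists (K : topologicalType) (e : X -> K) (h : S -> K -> R),
    [/\ compact [set: K], hausdorff_space K, embedding e & dense (range e)] /\
    [/\ forall s, continuous (h s), forall s k, 0 <= h s k <= 1,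
        forall s x, h s (e x) = g s x &
        forall k k', (forall s, h s k = h s k') -> k = k'].
Proof.
move=> hX g_cont g01 g_sep.
pose P : topologicalType := prod_topology (fun _ : S => R).
pose e0 (x : X) : P := fun s => g s x.
pose A : set P := closure (range e0).
pose cube : set P := [set f | forall s, `[0, 1]%classic (f s)].
have hP : hausdorff_space P by apply: hausdorff_product => _; exact: Rhausdorff.
have ccube : compact cube.
  apply: (@tychonoff S (fun=> R : topologicalType) (fun=> `[0, 1]%classic)) => _.
  exact: segment_compact.
have Acube : A `<=` cube.
  rewrite /A closureE; apply: smallest_sub; first exact: compact_closed.
  by move=> _ [x _ <-] s; rewrite /= in_itv; exact: g01.
have pr_cont (s : S) : continuous (fun f : P => f s).
  by move=> f; exact: (@proj_continuous S (fun=> R : topologicalType) s f).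
have e0_cont : continuous e0.
  move=> x; apply/cvg_sup => s; move: x.
  apply/(@continuousP _ (initial_topology (fun f : P => f s))) => _ [B oB <-].
  by apply: (@open_comp _ _ (g s)) => // y _; exact: g_cont.
pose K : topologicalType := set_type A.
pose e x : K := SigSub (mem_set (subset_closure (imageT e0 x))).
pose h s (k : K) : R := val k s.
have he s x : h s (e x) = g s x by [].
have h_cont s : continuous (h s).
  move=> k; exact: (@continuous_comp _ _ _ (val : K -> P) (fun f : P => f s) k
    (@val_set_type_continuous P A k) (pr_cont s (val k))).
have e_cont : continuous e.
  by apply: continuous_comp_initial; exact: e0_cont.
exists K, e, h; split; last first.
  split=> // [s k|k k' kk'].
    by have := Acube _ (set_valP k) s; rewrite /= in_itv.
  by apply: val_inj; apply/funext => s; exact: kk'.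
split.
- by apply: compact_set_type; apply: subclosed_compact Acube => //; exact: closed_closure.
- exact: hausdorff_set_type.
- split=> //.
    move=> x y exy; apply: contrapT => xy.
    have [||s [gx gy]] := g_sep (~` [set y]) x.
    + by apply/closed_openC/accessible_closed_set1/hausdorff_accessible.
    + by move=> /= yx; apply: xy.
    + have : h s (e x) = h s (e y) by rewrite exy.
      rewrite !he gx gy; first by move/esym/eqP; rewrite oner_eq0.
      by move=> /= yy; apply: yy.
  move=> U oU.
  (* The open set is the union of the sets [h s < 1] over the functions equal to [1] off [U]: on the
     image of [X] it cuts out exactly [U]. *)
  exists (\bigcup_(s in [set s | forall y, ~ U y -> g s y = 1]) [set k | h s k < 1]).
    apply: bigcup_open => s _; apply: (@open_comp _ _ (h s) [set t | t < 1]).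
      by move=> k _; exact: h_cont.
    exact: open_lt.
  apply/seteqP; split=> [_ [x Ux <-]|_ [[x _ <-] [s /= sU hs1]]].
    split; first by exists x.
    have [s [gx gy]] := g_sep U x oU Ux.
    by exists s => //; rewrite /mkset he gx ltr01.
  exists x => //; apply: contrapT => /sU gx.
  by move: hs1; rewrite he gx ltxx.
- apply/dense_closure/seteqP; split=> // k _ U /nbhs_set_typeP[W Wk WU].
  have [_ [[x _ <-] Wx]] := set_valP k W (open_nbhs_nbhs Wk).
  by exists (e x); split; [exists x|exact: WU].
Qed.

(** * Bases *)

Lemma basis_nbhs (T : topologicalType) (B : set (set T)) (U : set T) (x : T) :
  basis B -> open U -> U x -> exists V, [/\ B V, V x & V `<=` U].
Proof.
move=> [_ /(_ x) Bx] oU Ux; have [V [BV Vx] VU] := Bx _ (open_nbhs_nbhs (conj oU Ux)).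
by exists V.
Qed.

Lemma basisP (T : topologicalType) (B : set (set T)) :
  (forall U, B U -> open U) ->
  (forall U x, open U -> U x -> exists V, [/\ B V, V x & V `<=` U]) -> basis B.
Proof.
move=> Bo BU; split=> // x U; rewrite nbhsE => -[V [oV Vx] VU].
by have [W [BW Wx WV]] := BU V x oV Vx; exists W => //; exact: subset_trans VU.
Qed.

Lemma exists_least_basis (T : topologicalType) : exists B : set (set T), least_basis B.
Proof.
have [|B bB Bmin] := @exists_least_card (set T) [set B : set (set T) | basis B].
  by exists open; apply: basisP => // U x oU Ux; exists U; split.
by exists B.
Qed.

(** Hence the weight of [S] is at most that of [T]. *)
Lemma embedding_basis (S T : topologicalType) (e : S -> T) (B : set (set T)) :
  embedding e -> basis B -> basis [set e @^-1` V | V in B].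
Proof.
move=> [e_cont e_inj e_open] bB; apply: basisP => [_ [V BV <-]|U x oU Ux].
  by apply: open_comp => [y _|]; [exact: e_cont|exact: bB.1].
have [W oW eUW] := e_open U oU.
have [V [BV Vex VW]] : exists V, [/\ B V, V (e x) & V `<=` W].
  apply: basis_nbhs => //; have : (range e `&` W) (e x) by rewrite -eUW; exists x.
  by case.
exists (e @^-1` V); split=> [||y /= Vey]; [by exists V|by []|].
have : (e @` U) (e y) by rewrite eUW; split; [exists y|exact: VW].
by case=> z Uz /e_inj <-.
Qed.

(** With finitely many basic sets, those containing [x] have an open intersection, which is
    [[set x]] because points are closed; this clopen singleton contradicts connectedness. *)
Lemma infinite_basis (T : topologicalType) (B : set (set T)) (x y : T) :
  accessible_space T -> connected [set: T] -> basis B -> x <> y -> infinite_set B.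
Proof.
move=> aT cT bB xy finB.
have /finite_fsetP[D BxD] : finite_set [set U | B U /\ U x].
  by apply: sub_finite_set finB => U [].
have ox : open [set x].
  rewrite openE => _ ->.
  have : nbhs x (\bigcap_(U in [set U | B U /\ U x]) U).
    rewrite BxD; apply: filter_bigI => U UD.
    have [BU Ux] : [set U | B U /\ U x] U by rewrite BxD.
    by apply: open_nbhs_nbhs; split => //; exact: bB.1.
  apply: filterS => z zD; apply: contrapT => zx.
  have [|xz|U [BU Ux Uz]] := @basis_nbhs _ B (~` [set z]) x bB.
  - by apply/closed_openC/accessible_closed_set1.
  - by apply: zx; rewrite /= xz.
  - by apply: (Uz z) => //; exact: (zD U).
have xT : [set x] = [set: T].
  apply: cT; first by exists x.
    by exists [set x]; rewrite ?setTI.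
  by exists [set x]; rewrite ?setTI//; exact: accessible_closed_set1.
by apply: xy; have : [set: T] y by []; rewrite -xT => ->.
Qed.

Lemma metrizable_open_ball (R : realType) (T : topologicalType) (dist : T -> T -> R)
    (x : T) (r : R) : metric_on dist ->
  (forall x : T, nbhs x =
    filter_from [set e | 0 < e] (fun e => [set y | dist x y < e])) ->
  open [set y | dist x y < r].
Proof.
move=> [_ _ _ tri] nbhsE'; rewrite openE => y /= xy; rewrite /interior nbhsE'.
exists (r - dist x y) => /=; first by rewrite subr_gt0.
by move=> z /= yz; have := tri x y z; lra.
Qed.

Lemma separable_metrizable_countable_basis (R : realType) (T : topologicalType) :
  separable T -> metrizable R T -> exists2 B : set (set T), countable B & basis B.
Proof.
move=> [D cD dD] [dist dm nbhsE']; have [dxx _ sym tri] := dm.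
pose ball_ (i : T * nat) := [set y | dist i.1 y < i.2.+1%:R^-1].
exists (ball_ @` (D `*` setT)).
  by apply: sub_countable (card_image_le _ _) _; exact: countableX.
apply: basisP => [_ [i _ <-]|U x oU Ux]; first exact: (metrizable_open_ball _ _ dm).
have : nbhs x U by exact: open_nbhs_nbhs.
rewrite nbhsE' => -[e /= e0 eU].
(* The radius [1 / (n + 1)] is below [e / 2], so a ball of this radius that contains [x] lies within
   distance [e] of [x]. *)
pose n := Num.truncn (e / 2)^-1.
have ne : n.+1%:R^-1 < e / 2.
  rewrite invf_plt ?posrE ?ltr0n//; last lra.
  exact: truncnS_gt.
have n0 : 0 < n.+1%:R^-1 :> R by rewrite invr_gt0 ltr0n.
have [p [/= xp Dp]] := dD [set y | dist x y < n.+1%:R^-1]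
  (ex_intro _ x (eq_ind_r (fun t => t < n.+1%:R^-1) n0 (dxx x)))
  (metrizable_open_ball x _ dm nbhsE').
exists (ball_ (p, n)); split; first by exists (p, n).
  by rewrite /ball_/= sym.
move=> y; rewrite /ball_/= => py; apply: eU => /=.
apply: le_lt_trans (tri x p y) _; rewrite [e]splitr.
by apply: ltrD; apply: lt_trans ne.
Qed.

(** * The irreducible compactification *)

(** This is regularity: normality applied to the closed set [[set x]]. *)
Lemma nbhs_between (T : topologicalType) (U : set T) (x : T) :
  normal_space T -> accessible_space T -> open U -> U x ->
  exists V, [/\ open V, V x & closure V `<=` U].
Proof.
move=> nT aT oU Ux; have /nT : closed [set x] by exact: accessible_closed_set1.
move=> /(_ U)[_ ->|V xV VU]; first exact: open_nbhs_nbhs.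
have : nbhs x V by exact: xV.
rewrite nbhsE => -[W [oW Wx] WV]; exists W; split => //.
exact: subset_trans (closureS WV) VU.
Qed.

(* A point [q] of both closures other than [e p] would be a limit of both [C `\` U]
   and [D `\` U] for some neighbourhood [U] of [p], but [h] is [0] on the former
   and [1] on the latter. *)
Lemma closure_meet_point (R : realType) (X K : topologicalType) (e : X -> K)
    (C D : set X) (p : X) :
  hausdorff_space K -> continuous e ->
  (forall U, open U -> U p -> exists h : K -> R, [/\ continuous h,
    forall x, C x -> ~ U x -> h (e x) = 0 & forall x, D x -> ~ U x -> h (e x) = 1]) ->
  closure (e @` C) `&` closure (e @` D) `<=` [set e p].
Proof.
move=> hK e_cont sep q [qC qD]; apply: contrapT => /eqP qp.
move: hK; rewrite open_hausdorff => /(_ q (e p) qp)[[W V] /=].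
rewrite !inE => -[Wq Vp] [oW oV WV0].
have [||h [h_cont h0 h1]] := sep (e @^-1` V); [|by []|].
  by apply: open_comp => // x _; exact: e_cont.
have limit A (c : R) : closure (e @` A) q ->
    (forall x, A x -> ~ V (e x) -> h (e x) = c) -> h q = c.
  move=> qA hc; apply: contrapT => /eqP hqc.
  have : nbhs q (W `&` [set k | h k != c]).
    apply: open_nbhs_nbhs; split=> //; apply: openI => //.
    apply: (@open_comp _ _ h [set t | t != c]); first by move=> k _; exact: h_cont.
    exact: open_neq.
  move=> /qA[_ [[x Ax <-] [Wx /= /eqP]]]; apply.
  apply: hc => // Vx; suff : (W `&` V) (e x) by rewrite WV0.
  by [].
have := limit _ _ qC h0; rewrite (limit _ _ qD h1) => /eqP.
by rewrite oner_eq0.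
Qed.

Lemma irreducible_of_cuts (X K : topologicalType) d (L : orderType d) (f : X -> L)
    (e : X -> K) (D : set X) :
  [set: X] !=set0 -> compact [set: K] -> hausdorff_space K -> continuous e ->
  dense (range e) -> dense D ->
  (forall p, D p -> closure (e @` [set x | (f x <= f p)%O]) `&`
    closure (e @` [set x | (f p <= f x)%O]) `<=` [set e p]) ->
  exists a b, @irreducible_between K a b.
Proof.
move=> [x0 _] cK hK e_cont dK dD cut.
pose Lo p := e @` [set x | (f x <= f p)%O].
pose Up p := e @` [set x | (f p <= f x)%O].
(* A chain of nonempty sets is a filter base, and a cluster point of it lies in all their closures;
   [a] and [b] arise so from the initial and the final rays. *)
have end_pt (P : X -> set K) : (forall p, P p !=set0) ->
    (forall p q, P p `<=` P q \/ P q `<=` P p) -> exists a, forall p, closure (P p) a.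
  move=> P0 Ptot.
  have FF : ProperFilter (filter_from setT P).
    apply: filter_from_proper; last by move=> p _; exact: P0.
    apply: filter_from_filter; first by exists x0.
    move=> p q _ _; have [pq|qp] := Ptot p q.
      by exists p => // k Pk; split=> //; exact: pq.
    by exists q => // k Pk; split=> //; exact: qp.
  have [a [_ clFa]] := cK _ FF filterT.
  by exists a => p U; apply: clFa; exists p.
have [||a aLo] := end_pt Lo.
- by move=> p; exists (e p), p => //=.
- move=> p q; have [pq|qp] := leP (f p) (f q); [left|right] => _ [x xp <-];
    exists x => //; [exact: le_trans pq|exact: le_trans (ltW qp)].
have [||b bUp] := end_pt Up.
- by move=> p; exists (e p), p => //=.
- move=> p q; have [pq|qp] := leP (f p) (f q); [right|left] => _ [x xp <-];
    exists x => //; [exact: le_trans xp|exact: le_trans (ltW qp) xp].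
exists a, b => A [cA kA] Aa Ab.
have LoUp p : closure (Lo p) `|` closure (Up p) = setT.
  rewrite -closureU; apply/dense_closure => O O0 oO.
  have [k [Ok [x _ xk]]] := dK O O0 oO; exists k; split=> //; rewrite -xk.
  by have [xp|px] := leP (f x) (f p); [left|right]; exists x => //=; exact: ltW.
have DA p : D p -> A (e p).
  move=> Dp; apply: contrapT => nA.
  have disj k : A k -> closure (Lo p) k -> closure (Up p) k -> False.
    by move=> Ak kL kU; apply: nA; rewrite -(cut p Dp k).
  (* If [A] misses [e p], the two closures cut [A] into disjoint relatively closed pieces. The piece
     in [closure (Lo p)] contains [a], so by connectedness it is all of [A] and contains [b], which
     also lies in [closure (Up p)]. *)
  have AL : A `&` closure (Lo p) = A.
    apply: kA; first by exists a.
      exists (~` closure (Up p)); first exact/closed_openC/closed_closure.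
      apply/seteqP; split=> k [Ak kL]; split=> //; first exact: disj kL.
      by have : [set: K] k by []; rewrite -(LoUp p) => -[].
    by exists (closure (Lo p)) => //; exact: closed_closure.
  by apply: (disj b Ab) => //; have : A b := Ab; rewrite -{1}AL => -[].
have clA : closed A := compact_closed hK cA.
(* [A] is closed and contains the image of [D], which is dense in [K] because [D] is dense in [X]
   and [X] has dense image. *)
apply/seteqP; split=> // k _; rewrite [A](iffLR (closure_id _) clA) => U Uk.
move: Uk; rewrite nbhsE => -[V [oV Vk] VU].
have [k' [Vk' [x _ xk]]] := dK V (ex_intro _ k Vk) oV.
have Vx : V (e x) by rewrite xk.
have [p [/= Vp Dp]] := dD (e @^-1` V) (ex_intro _ x Vx)
  (open_comp (fun x _ => e_cont x) oV).
by exists (e p); split; [exact: DA|exact: VU].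
Qed.

Lemma irreducible_compactification (R : realType) (X : topologicalType)
    d (L : orderTopologicalType d) (f : X -> L) (B : set (set X)) :
  [set: X] !=set0 -> connected [set: X] -> normal_space X -> hausdorff_space X ->
  continuous f -> injective f -> basis B ->
  exists (K : topologicalType) (e : X -> K)
      (h : bool * set_type B * set_type B -> K -> R),
    [/\ irreducible_continuum K, embedding e & dense (range e)] /\
    [/\ forall s, continuous (h s), forall s k, 0 <= h s k <= 1 &
        forall k k', (forall s, h s k = h s k') -> k = k'].
Proof.
move=> [x0 _] cX nX hX f_cont f_inj bB.
have aX : accessible_space X by exact: hausdorff_accessible.
have sepX := iffLR (@normal_separatorP R X) nX.
have /choice[pt ptP] : forall V : set X, exists x, V !=set0 -> V x.
  move=> V; have [[x Vx]|nV] := pselect (V !=set0); first by exists x.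
  by exists x0.
pose lo p U := [set x | (f x <= f p)%O] `\` U.
pose up p U := [set x | (f p <= f x)%O] `\` U.
(* The boolean selects the kind of function: [true] for cuts at chosen points, [false] for
   separating points from closed sets. All pairs are indexed, since continuity and the range hold
   for every pair; separation is invoked only where the two sets are disjoint and closed. *)
pose g (s : bool * set_type B * set_type B) : X -> R :=
  if s.1.1 then Urysohn (lo (pt (val s.1.2)) (val s.2)) (up (pt (val s.1.2)) (val s.2))
  else Urysohn (closure (val s.1.2)) (~` (val s.2)).
have g_cont s : continuous (g s).
  by rewrite /g; case: ifP => _; exact: Urysohn_continuous.
have g01 s x : 0 <= g s x <= 1.
  suff : range (g s) `<=` `[0, 1] by move=> /(_ (g s x)) /=; rewrite in_itv; apply; exists x.
  by rewrite /g; case: ifP => _; exact: Urysohn_range.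
have [|K [e [h [[cK hK eK dK] [h_cont h01 he h_sep]]]]] :=
    @cube_compactification R X _ g hX g_cont g01.
  move=> U x oU Ux; have [V [BV Vx VU]] := basis_nbhs bB oU Ux.
  (* Both indices must be members of [B], so [W] is shrunk to a basic [W'] whose closure still lies
     in [V]. *)
  have [W [oW Wx clW]] := nbhs_between nX aX (bB.1 _ BV) Vx.
  have [W' [BW' W'x W'W]] := basis_nbhs bB oW Wx.
  exists (false, SigSub (mem_set BW'), SigSub (mem_set BV)); rewrite /g/=.
  have sep : uniform_separator (closure W') (~` V).
    apply: sepX; first exact: closed_closure.
      exact/open_closedC/bB.1.
    by apply/disjoints_subset; rewrite setCK; apply: subset_trans clW; exact: closureS.
  split; first by apply: (@Urysohn_sub0 X R _ _ sep); exists x => //; exact: subset_closure.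
  by move=> y nUy; apply: (@Urysohn_sub1 X R _ _ sep); exists y => // Vy; apply/nUy/VU.
exists K, e, h; split=> //; split=> //; have [e_cont e_inj _] := eK.
split.
  split=> //.
  (* [K] is the closure of the connected image of [X]. *)
  have := connected_closure (connected_continuous_connected cX
    (continuous_subspaceT e_cont)).
  by rewrite (iffLR (dense_closure _) dK).
apply: (@irreducible_of_cuts X K d L f e (pt @` [set V | B V /\ V !=set0])) => //.
- by exists x0.
- move=> O [x Ox] oO; have [V [BV Vx VO]] := basis_nbhs bB oO Ox.
  have V0 : V !=set0 by exists x.
  exists (pt V); split; [apply: VO; exact: ptP|by exists V].
move=> _ [V [BV V0] <-]; apply: (@closure_meet_point R) => // U oU Up.
have [W [BW Wp WU]] := basis_nbhs bB oU Up.
pose s := (true, SigSub (mem_set BV) : set_type B, SigSub (mem_set BW) : set_type B).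
have sep : uniform_separator (lo (pt V) W) (up (pt V) W).
  apply: sepX.
  - apply: closedI; last exact/open_closedC/bB.1.
    by apply: (@preimage_closed _ _ f [set` `]-oo, f (pt V)]]) => [x _|];
      [exact: f_cont|exact: lray_closed].
  - apply: closedI; last exact/open_closedC/bB.1.
    have -> : [set x | (f (pt V) <= f x)%O] = f @^-1` [set` `[f (pt V), +oo[].
      by apply/seteqP; split=> x /=; rewrite in_itv/= andbT.
    by apply: preimage_closed => [x _|];
      [exact: f_cont|exact: rray_closed].
  (* A common point would have the same [f]-value as [pt V], hence equal it by injectivity; but
     [pt V] lies in [W]. *)
  - apply/seteqP; split=> // x [[/= xp nWx] [/= px _]].
    by apply: nWx; rewrite (f_inj x (pt V))//; apply/le_anti; rewrite xp px.
exists (h s); split=> // x /= xp nUx; rewrite he /g/=.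
  apply: (@Urysohn_sub0 X R _ _ sep); exists x => //; split => // Wx; exact/nUx/WU.
apply: (@Urysohn_sub1 X R _ _ sep); exists x => //; split => // Wx; exact/nUx/WU.
Qed.

(** * Weight and metrizability of the compactification *)

Lemma same_weight_compactification (R : realType) (X K : topologicalType)
    (e : X -> K) (B : set (set X)) (h : bool * set_type B * set_type B -> K -> R) :
  least_basis B -> infinite_set B ->
  compact [set: K] -> hausdorff_space K -> embedding e ->
  (forall s, continuous (h s)) ->
  (forall k k', (forall s, h s k = h s k') -> k = k') -> same_weight X K.
Proof.
move=> [bB Bmin] infB cK hK eK h_cont h_sep.
have [C [bC Cmin]] := exists_least_basis K.
exists B, C; split=> //; rewrite card_eq_le; apply/andP; split.
  apply: card_le_trans (card_image_le (fun V => e @^-1` V) C).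
  exact/Bmin/embedding_basis.
(* The boxes are indexed by finite lists; since [B] is infinite, each list entry, and then each
   list, is coded by a member of [B]. *)
apply: card_le_trans (Cmin _ (basis_box cK hK h_cont h_sep)) _.
apply: card_le_trans (card_image_le _ _) _.
have infT : infinite_set [set: set_type B].
  have := card_setT B; rewrite card_eq_le => /andP[_ BT].
  by apply/infiniteP; apply: card_le_trans BT; exact/infiniteP.
have [t0 _] := infinite_setN0 infT.
have [c c_inj] := infinite_seq_coding infT.
(* A natural number is coded by the constant list of that length. *)
pose cn n := c (nseq n t0).
have cn_inj : injective cn.
  by move=> m n /c_inj /(congr1 size); rewrite !size_nseq.
pose ci (i : bool * set_type B * set_type B * rat * bool) :=
  c [:: cn i.1.1.1.1; i.1.1.1.2; i.1.1.2; cn (pickle i.1.2); cn i.2].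
have ci_inj : injective ci.
  move=> [[[[b U] V] r] b'] [[[[b2 U2] V2] r2] b2'] /c_inj[].
  move=> /cn_inj e1 -> -> /cn_inj/(pcan_inj pickleK) -> /cn_inj e2.
  by move: e1 e2; case: b; case: b2 => //; case: b'; case: b2'.
apply: (@set_inj_card_le _ _ _ _ (fun l => val (c (map ci l)))).
  by move=> l _; exact: set_valP.
by move=> l m _ _ /val_inj/c_inj/(inj_map ci_inj).
Qed.

Lemma metrizable_compactification (R : realType) (X K : topologicalType)
    (B : set (set X)) (h : bool * set_type B * set_type B -> K -> R) :
  countable B -> compact [set: K] -> hausdorff_space K ->
  (forall s, continuous (h s)) -> (forall s k, 0 <= h s k <= 1) ->
  (forall k k', (forall s, h s k = h s k') -> k = k') -> metrizable R K.
Proof.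
move=> cB cK hK h_cont h01 h_sep.
have /(card_le_set_inj 0%N)[j [_ j_inj]] := cB.
pose code (s : bool * set_type B * set_type B) : nat :=
  pickle (s.1.1, j (val s.1.2), j (val s.2)).
have code_inj : injective code.
  move=> [[b U] V] [[b' U'] V'] /(pcan_inj pickleK)[-> /j_inj eU /j_inj eV].
  by congr (_, _, _); apply: val_inj; [apply: eU|apply: eV]; exact: set_valP.
(* Numbers that code no index receive the zero function, which is continuous with values in
   [[0, 1]]. *)
pose g n : K -> R := if pselect (exists s, code s = n) is left ex
  then h (projT1 (cid ex)) else fun=> 0.
have gE s : g (code s) = h s.
  rewrite /g; case: pselect => [ex|[]]; last by exists s.
  by congr h; apply: code_inj; exact: projT2 (cid ex).
apply: (@compact_metrizable R K g) => //.
- move=> n; rewrite /g; case: pselect => // _; exact: cst_continuous.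
- by move=> n k; rewrite /g; case: pselect => // _; rewrite lexx ler01.
- by move=> k k' gk; apply: h_sep => s; rewrite -gE.
Qed.

(** [normal_space] does not include the separation of points; for a weakly orderable space it is
    pulled back from the arc. *)
Lemma hausdorff_injection (X Y : topologicalType) (f : X -> Y) :
  hausdorff_space Y -> continuous f -> injective f -> hausdorff_space X.
Proof.
move=> hY f_cont f_inj x y clxy; apply: f_inj; apply: hY => U V nU nV.
have [||z [Uz Vz]] := clxy (f @^-1` U) (f @^-1` V); [exact: f_cont|exact: f_cont|].
by exists (f z).
Qed.

Lemma singleton_irreducible_continuum (X : topologicalType) (a : X) :
  (forall x, x = a) -> irreducible_continuum X.
Proof.
move=> Xa; have Xset : [set: X] = [set a] by apply/seteqP; split=> x // _; exact: Xa.
split; first split.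
- by move=> x y _; rewrite (Xa x) (Xa y).
- by rewrite Xset; exact: compact_set1.
- by rewrite Xset; exact: connected1.
- by exists a, a => A _ Aa _; apply/seteqP; split=> // x _; rewrite (Xa x).
Qed.

Lemma densely_embeds_refl (X : topologicalType) : densely_embeds X X.
Proof.
exists id; split.
  split=> [x|//|U oU]; first exact: cvg_id.
  by exists U => //; rewrite image_id image_id setTI.
by move=> O [x Ox] oO; exists x; split => //; exists x.
Qed.

Unset Implicit Arguments.
Set Strict Implicit.

Theorem theorem3p6 (R : realType) (X : topologicalType)
    (X_nonempty : [set: X] !=set0)
    (X_connected : connected [set: X])
    (X_weakly_orderable : weakly_orderable X)
    (X_normal : normal_space X) :
  (exists K : topologicalType,
     [/\ irreducible_continuum K, same_weight X K & densely_embeds X K]) /\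
  (separable X -> metrizable R X ->
   exists K : topologicalType,
     [/\ irreducible_continuum K, metrizable R K & densely_embeds X K]).
Proof.
have [d [L [f [[hL _ _] f_cont f_inj]]]] := X_weakly_orderable.
have hX := hausdorff_injection hL f_cont f_inj.
have compactify B := @irreducible_compactification R X d L f B X_nonempty X_connected
  X_normal hX f_cont f_inj.
split=> [|sepX metX]; last first.
  have [B cB bB] := separable_metrizable_countable_basis sepX metX.
  have [K [e [h [[iK eK dK] [h_cont h01 h_sep]]]]] := compactify B bB.
  have [[hK cK _] _] := iK.
  exists K; split=> //; last by exists e.
  exact: (@metrizable_compactification R X K B h).
have [B lB] := exists_least_basis X.
have [a _] := X_nonempty.
(* A one-point space is its own compactification. With two points every basis is infinite, as the
   cardinal count requires. *)
have [[b ab]|Xa] := pselect (exists b, b <> a); last first.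
  exists X; split; [apply: (@singleton_irreducible_continuum X a)| |exact: densely_embeds_refl].
    by move=> x; apply: contrapT => xa; apply: Xa; exists x.
  by exists B, B; split.
have [K [e [h [[iK eK dK] [h_cont h01 h_sep]]]]] := compactify B lB.1.
have [[hK cK _] _] := iK.
exists K; split=> //; last by exists e.
apply: (@same_weight_compactification R X K e B h) => //.
exact: (infinite_basis (hausdorff_accessible hX) X_connected lB.1 ab).
Qed.
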